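(* Let $(\mathfrak h,(H_i,L_i)_{i\in I})$ be a linear Coxeter system with linear Coxeter group $\mathcal W$, closed fundamental chamber $\overline C$ and Tits cone $X$. Let $Y\subseteq X$ be a $\mathcal W$-invariant convex subcone containing $0$. The linear hull of $R\in\Upsilon$ is given by $$R-R=(R\cap\overline C)-(R\cap\overline C)=\big(R\cap\overline F_{\upsilon_*(R)}\big)-\big(R\cap\overline F_{\upsilon_*(R)}\big).$$
   Context: $\mathbb R^+=(0,\infty)$. A convex cone is a subset of a real vector space closed under addition and under multiplication by elements of $\mathbb R^+$. $\mathrm{ri}$ denotes the relative interior of a finite-dimensional convex set; for sets $S,T$ in a vector space $S-T=\{s-t\mid s\in S,t\in T\}$. For a convex cone $K$ containing $0$, a face of $K$ is a convex cone $F\subseteq K$ with $(K\setminus F)+K\subseteq K\setminus F$; $\mathrm{Fa}(K)$ is the set of nonempty faces, ordered by inclusion. Linear Coxeter systems. Let $\mathfrak h$ be a finite-dimensional real vector space, $n\ge1$, $I=\{1,\dots,n\}$. For a zero-based closed ray $H\subseteq\mathfrak h$ put $H^{\ge0}=\{\lambda\in\mathfrak h^*\mid\lambda(h)\ge0\ \forall h\in H\}$, $H^{>0}=\{\lambda\mid\lambda(h)>0\ \forall h\in H\setminus\{0\}\}$, $H^{=0}=\{\lambda\mid\lambda(h)=0\ \forall h\in H\}$. A linear Coxeter system $(\mathfrak h,(H_i,L_i)_{i\in I})$ consists of zero-based closed rays $H_i\subseteq\mathfrak h$, $L_i\subseteq\mathfrak h^*$ with $L_i\setminus\{0\}\subseteq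 H_i^{>0}$ such that: (1) the closed fundamental chamber $\overline C=\bigcap_{i\in I}H_i^{\ge0}$ spans $\mathfrak h^*$, and $\overline C\cap H_i^{=0}$, $i\in I$, are its pairwise different faces of codimension 1; (2) with $C=\bigcap_{i\in I}H_i^{>0}$ and $\mathcal W$ (the linear Coxeter group) the group generated by the reflections $\sigma_i$ on $\mathfrak h^*$ at the hyperplane $H_i^{=0}$ along the line $L_i\cup(-L_i)$, one has $\sigma C\cap C=\emptyset$ for all $\sigma\in\mathcal W\setminus\{1\}$. The Tits cone is the convex cone $X=\bigcup_{\sigma\in\mathcal W}\sigma\overline C$. For each $i$ fix $h_i\in H_i\setminus\{0\}$. For $J\subseteq I$ set $\overline F_J=\{\lambda\in\mathfrak h^*\mid\lambda(h_i)=0\ (i\in J),\ \lambda(h_i)\ge0\ (i\in I\setminus J)\}$. $\Upsilon=\{R\in\mathrm{Fa}(Y)\mid\mathrm{ri}(R)\cap\overline C\ne\emptyset\}$. For $R\in\Upsilon$: $\upsilon_*(R)=\{i\in I\mid\sigma_i\text{ fixes }R\text{ pointwise}\}=\{i\in I\mid R-R\subseteq H_i^{=0}\}$. *)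

(* Defs.v *)
From HB Require Import structures.
From mathcomp Require Import all_boot all_order all_algebra.
From mathcomp Require Import all_classical all_reals all_analysis.
Set Implicit Arguments.
Unset Strict Implicit.
Unset Printing Implicit Defensive.
Import Order.TTheory GRing.Theory Num.Theory.
Import numFieldNormedType.Exports.
Local Open Scope classical_set_scope.
Local Open Scope ring_scope.

Notation dual R V := 'Hom(V, R^o).

Section Convexity.
Variables (R : realType) (E : vectType R).
Implicit Types (S T K F : set E).

Definition set_add S T : set E := [set x + y | x in S & y in T].
Definition set_sub S T : set E := [set x - y | x in S & y in T].

(* The empty set is a convex cone, and 0 need not belong to a convex cone. *)
Definition convex_cone S : Prop :=
  (forall x y, S x -> S y -> S (x + y)) /\
  (forall (t : R) x, 0 < t -> S x -> S (t *: x)).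

Definition face K F : Prop :=
  [/\ convex_cone F, F `<=` K & set_add (K `\` F) K `<=` K `\` F].

Definition Fa K : set (set E) := [set F | face K F /\ F !=set0].

Definition lin_hull S : set E :=
  smallest [set A | exists U : {vspace E}, A = [set x | x \in U]] S.

Definition affine_subset S : Prop :=
  forall x y (t : R), S x -> S y -> S ((1 - t) *: x + t *: y).

Definition aff_hull S : set E := smallest affine_subset S.

(* The topology of E is that of R^(dim E), read through the coordinates in a
   basis of E. *)
Definition rel_interior S : set E :=
  [set x | S x /\
    \forall r \near (passmx.rVof (vbasis {:E}) x : 'rV[R]_(\dim {:E})),
      aff_hull S (passmx.vecof (vbasis {:E}) r) -> S (passmx.vecof (vbasis {:E}) r)].

Definition has_dim S (d : nat) : Prop :=
  exists2 U : {vspace E}, lin_hull S = [set x | x \in U] & \dim U = d.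

Definition codim1 K F : Prop := exists2 d, has_dim F d & has_dim K d.+1.

Definition closed_ray S : Prop :=
  exists2 v : E, v != 0 & S = [set t *: v | t in [set t : R | 0 <= t]].

Definition is_subgroup (G : set 'End(E)) : Prop :=
  [/\ G \1%VF,
      forall f g, G f -> G g -> G (f \o g)%VF &
      forall f, G f -> exists2 g, G g & (f \o g)%VF = \1%VF /\ (g \o f)%VF = \1%VF].

Definition generated_group (A : set 'End(E)) : set 'End(E) :=
  smallest is_subgroup A.

Definition is_reflection (M D : set E) (s : 'End(E)) : Prop :=
  (forall x, M x -> s x = x) /\ (forall x, D x -> s x = - x).

End Convexity.

Section CoxeterSystem.
Variables (R : realType) (V : vectType R) (n : nat).
Variables (H : 'I_n -> set V) (L : 'I_n -> set (dual R V)).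

Definition ray_ge0 (S : set V) : set (dual R V) :=
  [set l | forall x, S x -> 0 <= (l x : R)].
Definition ray_gt0 (S : set V) : set (dual R V) :=
  [set l | forall x, S x -> x != 0 -> 0 < (l x : R)].
Definition ray_eq0 (S : set V) : set (dual R V) :=
  [set l | forall x, S x -> (l x : R) = 0].

Definition closed_chamber : set (dual R V) := \bigcap_i ray_ge0 (H i).
Definition open_chamber : set (dual R V) := \bigcap_i ray_gt0 (H i).

(* The default value \1 is never used for a linear Coxeter system: see reflP. *)
Definition refl (i : 'I_n) : 'End(dual R V) :=
  xget \1%VF
    [set s | is_reflection (ray_eq0 (H i)) (L i `|` [set - x | x in L i]) s].

Definition coxeter_group : set 'End(dual R V) := generated_group (range refl).

Definition tits_cone : set (dual R V) :=
  \bigcup_(s in coxeter_group) [set s x | x in closed_chamber].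

Record linear_coxeter_system : Prop := LinearCoxeterSystem {
  lcs_ray : forall i, closed_ray (H i);
  lcs_coray : forall i, closed_ray (L i);
  lcs_pos : forall i, L i `\ 0 `<=` ray_gt0 (H i);
  lcs_span : lin_hull closed_chamber = setT;
  lcs_walls_inj : injective (fun i => closed_chamber `&` ray_eq0 (H i));
  lcs_walls : [set F | Fa closed_chamber F /\ codim1 closed_chamber F] =
              range (fun i => closed_chamber `&` ray_eq0 (H i));
  lcs_free : forall s, coxeter_group s -> s != \1%VF ->
    [set s x | x in open_chamber] `&` open_chamber = set0
}.

Definition closed_facet (h : 'I_n -> V) (J : set 'I_n) : set (dual R V) :=
  [set l | (forall i, J i -> (l (h i) : R) = 0) /\
           (forall i, ~ J i -> 0 <= (l (h i) : R))].

Definition Upsilon (Y : set (dual R V)) : set (set (dual R V)) :=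
  [set F | Fa Y F /\ rel_interior F `&` closed_chamber !=set0].

Definition upsilon_star (F : set (dual R V)) : set 'I_n :=
  [set i | forall x, F x -> refl i x = x].

Lemma reflP (i : 'I_n) : linear_coxeter_system ->
  is_reflection (ray_eq0 (H i)) (L i `|` [set - x | x in L i]) (refl i).
Proof.
move=> S; have [v v0 Hv] := lcs_ray S i; have [l l0 Ll] := lcs_coray S i.
have lv : 0 < (l v : R).
  apply: (lcs_pos S (i := i)) => //.
    split; last by move/eqP; rewrite (negbTE l0).
    by rewrite Ll; exists 1; rewrite /= ?scale1r.
  by rewrite Hv; exists 1; rewrite /= ?scale1r.
pose f (x : dual R V) : dual R V := x - (2 * (x v : R) / (l v : R)) *: l.
have flin : linear f.
  move=> a x y; rewrite /f add_lfunE scale_lfunE -[_ *: x v]/(_ * x v : R).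
  rewrite mulrDr mulrDl scalerDl mulrCA -!mulrA -scalerA scalerBr.
  by rewrite opprD addrACA.
pose fL := GRing.isLinear.Build R _ _ _ f flin.
pose F : {linear dual R V -> dual R V} := HB.pack f fL.
apply: xgetPex; exists (linfun F).
have fl c : f (c *: l) = - (c *: l).
  rewrite /f scale_lfunE -[_ *: l v]/(_ * l v : R) [2 * _]mulrA mulfK ?gt_eqF//.
  by rewrite mulrDl mul1r scalerDl opprD addrA subrr add0r.
split=> x.
- move=> Mx; rewrite lfunE /= /f (Mx v) ?mulr0 ?mul0r ?scale0r ?subr0//.
  by rewrite Hv; exists 1; rewrite /= ?scale1r.
- rewrite lfunE /= Ll => -[[t _ <-]|[_ [t _ <-] <-]]; first exact: fl.
  by rewrite -scaleNr fl.
Qed.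

End CoxeterSystem.

(* Main.v *)
Require Import Defs.
From HB Require Import structures.
From mathcomp Require Import all_boot all_order all_algebra.
From mathcomp Require Import all_classical all_reals all_analysis.
From mathcomp Require Import lra.
Set Implicit Arguments.
Unset Strict Implicit.
Unset Printing Implicit Defensive.
Import Order.TTheory GRing.Theory Num.Theory.
Import numFieldNormedType.Exports.
Local Open Scope classical_set_scope.
Local Open Scope ring_scope.

(** Let [nu] lie in the relative interior of [F] and in the closed chamber [C].
  A point [y] of [F] is [u (v x)] with [x] in [C], [u] fixing [nu], and [v x] on
  the nonnegative side of the walls through [nu], by induction on a word: the
  only way to leave this side by passing to an adjacent chamber is to cross a
  wall through [nu], and the crossing reflection then moves into [u].  Hence
  [nu + d (v x)] lies in [C] for small [d > 0].  Elements fixing [nu] preserve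
  the face [F], so this point is in [F], and [y] lies in the image under [u] of
  the span [U] of [F `&` C].  So the countably many subspaces [u U] cover the
  convex cone [F]; one of them contains [F], and comparing dimensions, [U] is
  the span of [F]. *)

(** An injective [c] would make the interval []0, 1[] countable, hence of Lebesgue measure 0 instead
    of 1. *)
Lemma pos_not_inj_countable (R : realType) (T : countType) (c : R -> T) :
  exists s t : R, [/\ 0 < s, s < t & c s = c t].
Proof.
apply: contrapT => noncoll.
have cinj : {in `]0%R, 1%R[%classic &, injective c}.
  move=> s t; rewrite !inE /= !in_itv /= => /andP[s0 _] /andP[t0 _] est.
  case: (ltgtP s t) => // lt; case: noncoll; first by exists s, t.
  by exists t, s.
have /countable_lebesgue_measure0 : countable (`]0%R, 1%R[%classic : set R).
  apply/countable_injP; exists (pickle \o c) => s t s01 t01 /= est.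
  by apply: cinj => //; apply: (pcan_inj pickleK).
by rewrite lebesgue_measure_itv /= lte_fin ltr01 sube0 => /eqP; rewrite eqe oner_eq0.
Qed.

(** * Linear hulls, countable covers by subspaces, relative interiors *)

Section LinearHull.
Variables (R : realType) (E : vectType R).
Implicit Types (S : set E) (X : seq E).

(** Take a list in [S] whose span has maximal dimension: adjoining a point of [S] cannot enlarge the
    span. *)
Lemma exists_spanning_seq S : exists X, (forall x, x \in X -> S x) /\
  (forall x, S x -> x \in <<X>>%VS).
Proof.
pose P d := exists X, (forall x, x \in X -> S x) /\ \dim <<X>> = d.
have exP : exists d, `[< P d >].
  by exists 0%N; apply/asboolP; exists [::]; rewrite span_nil dimv0.
have leP d : `[< P d >] -> (d <= \dim {:E})%N.
  by move=> /asboolP[X [_ <-]]; rewrite dimvS // subvf.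
case: (ex_maxnP exP leP) => d /asboolP[X [XS dX]] dmax.
exists X; split=> // x Sx.
have : (\dim <<x :: X>> <= \dim <<X>>)%N.
  rewrite dX; apply: dmax; apply/asboolP; exists (x :: X); split=> // y.
  by rewrite inE => /orP[/eqP->|/XS].
have sX : (<<X>> <= <<x :: X>>)%VS by rewrite span_cons addvSr.
rewrite (geq_leqif (dimv_leqif_sup sX)) => /subvP; apply.
by rewrite memv_span // mem_head.
Qed.

Lemma lin_hull_span S X : (forall x, x \in X -> S x) ->
  (forall x, S x -> x \in <<X>>%VS) -> lin_hull S = [set x | x \in <<X>>%VS].
Proof.
move=> XS SX; apply/seteqP; split=> [x|x /= xX A [[U ->] SU] /=].
  by apply; split; [exists <<X>>%VS | exact: SX].
by apply: (subvP _ _ xX); apply/span_subvP => y /XS /SU.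
Qed.

(** Multiples of points of [S] lie in [S - S], negative ones as subtrahends, and [S - S] is closed
    under sums. *)
Lemma set_sub_span S X : convex_cone S -> S 0 -> (forall x, x \in X -> S x) ->
  (forall x, S x -> x \in <<X>>%VS) -> set_sub S S = [set x | x \in <<X>>%VS].
Proof.
move=> [SD SZ] S0 XS SX; apply/seteqP; split=> [_ [x Sx [y Sy <-]]|x] /=.
  by rewrite rpredB ?SX.
have subD x1 x2 : set_sub S S x1 -> set_sub S S x2 -> set_sub S S (x1 + x2).
  move=> [u Su [v Sv <-]] [u' Su' [v' Sv' <-]].
  exists (u + u'); first exact: SD.
  by exists (v + v'); [exact: SD | rewrite opprD addrACA].
have subZ a v : S v -> set_sub S S (a *: v).
  move=> Sv; case: (ltgtP a 0) => [a0|a0|->].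
  - exists 0 => //; exists (- a *: v); first by apply: SZ; rewrite ?oppr_gt0.
    by rewrite scaleNr opprK add0r.
  - by exists (a *: v); [exact: SZ | exists 0; rewrite ?subr0].
  - by exists 0 => //; exists 0; rewrite // scale0r subr0.
elim: X XS {SX} x => [_ x|v X IH XS x].
  by rewrite span_nil memv0 => /eqP->; exists 0 => //; exists 0; rewrite ?subr0.
rewrite span_cons => /memv_addP[_ /vlineP[a ->] [y yX ->]].
apply: subD; first by apply: subZ; apply: XS; rewrite mem_head.
by apply: IH => // z zX; apply: XS; rewrite inE zX orbT.
Qed.

(* Trading a pair [x, y] for the points [x + t y] with [t > 0]: two of these
   uncountably many points fall into the same member of the cover, which then
   contains [y] and [x]. *)
Lemma countable_subspace_cover (T : countType) (U : T -> {vspace E}) S :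
  convex_cone S -> (forall x, S x -> exists j, x \in U j) ->
  forall X x, S x -> (forall y, y \in X -> S y) ->
  exists j, x \in U j /\ {subset X <= U j}.
Proof.
move=> [SD SZ] SU; elim=> [x /SU[j xj] _|y X IH x Sx XS]; first by exists j.
have Sy : S y by apply: XS; rewrite mem_head.
(* A default index, the value of [c] at [t <= 0]. *)
have [j0 _] := SU _ Sx.
have /choice[c cP] (t : R) :
    exists j, 0 < t -> (x + t *: y) \in U j /\ {subset X <= U j}.
  have [t0|_] := boolP (0 < t); last by exists j0.
  have [||j jP] := IH (x + t *: y); last by exists j.
    by apply: SD => //; apply: SZ.
  by move=> z zX; apply: XS; rewrite inE zX orbT.
have [s [t [s0 st cst]]] := pos_not_inj_countable c.
have [sU XU] := cP _ s0.
have [tU _] := cP _ (lt_trans s0 st); rewrite -cst in tU.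
have yU : y \in U (c s).
  have : (t - s)^-1 *: ((x + t *: y) - (x + s *: y)) \in U (c s).
    by rewrite memvZ // rpredB.
  by rewrite opprD addrACA subrr add0r -scalerBl scalerA mulVf ?scale1r //
    gt_eqF // subr_gt0.
exists (c s); split=> [|z]; last by rewrite inE => /orP[/eqP->|/XU].
by rewrite -(addrK (s *: y) x) rpredB // memvZ.
Qed.

Lemma rel_interior_extend S x y : rel_interior S x -> S y ->
  exists2 d : R, 0 < d & S (x + d *: (x - y)).
Proof.
move=> [Sx /nbhs_ballP[e e0 eP]] Sy.
set b := vbasis {:E}.
have b_basis : basis_of {:E} b by exact: vbasisP.
pose rv : 'rV[R]_(\dim {:E}) := passmx.rVof b (x - y).
(* Each coordinate of [x - y] is smaller than [M] in absolute value, so a step of length [e / M]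
   moves every coordinate of [x] by less than [e]. *)
pose M : R := 1 + \sum_j `|rv 0 j|.
have M0 : 0 < M by rewrite ltr_pwDl // sumr_ge0.
have d0 : 0 < e / M by rewrite divr_gt0.
exists (e / M) => //.
have := eP (passmx.rVof b (x + (e / M) *: (x - y))).
rewrite /= passmx.rVofK //; apply.
  split=> // i j; rewrite ord1 [x + _]addrC passmx.rVof_linear -/rv !mxE /ball /=.
  rewrite opprD addrCA subrr addr0 normrN normrM gtr0_norm // -mulrA gtr_pMr //.
  rewrite mulrC ltr_pdivrMr // mul1r /M (bigD1 j) //=.
  rewrite addrCA mxE ltrDl ltr_pwDl // sumr_ge0 //.
(* The new point is on the line through [x] and [y], hence in the affine hull. *)
move=> A [Aaff SA].
have -> : x + (e / M) *: (x - y) = (1 - (- (e / M))) *: x + (- (e / M)) *: y.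
  by rewrite opprK scalerDl scale1r scalerBr scaleNr addrA.
by apply: Aaff; exact: SA.
Qed.

End LinearHull.

(** * Small positive parameters *)

Lemma exists_small (R : realType) (I : finType) (P : I -> R -> Prop) :
  (forall i, \forall d \near 0^'+, P i d) -> exists2 d : R, 0 < d & forall i, P i d.
Proof.
move=> /filter_forall Pnear.
have [d [d0 dP]] : exists d : R, 0 < d /\ forall i, P i d.
  apply: (@filter_ex _ (0 : R)^'+); near=> d; split.
    by near: d; exact: nbhs_right_gt.
  by near: d.
by exists d.
Unshelve. all: by end_near.
Qed.

Lemma near_right_affine_gt0 (R : realType) (u v : R) :
  0 < u -> \forall d \near 0^'+, 0 < u + d * v.
Proof.
move=> u0; have v0 : 0 < 1 + `|v| by rewrite ltr_pwDl.
near=> d.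
have d0 : 0 < d by near: d; exact: nbhs_right_gt.
have : d < u / (1 + `|v|) by near: d; apply: nbhs_right_lt; rewrite divr_gt0.
rewrite ltr_pdivlMr // => du.
have : - `|v| <= v by rewrite lerNl -normrN ler_norm.
nra.
Unshelve. all: by end_near.
Qed.

Lemma dual_affine (R : realType) (E : vectType R) (f : dual R E) x (d : R) y :
  (f (x + d *: y) : R) = (f x : R) + d * (f y : R).
Proof. by rewrite linearD linearZ. Qed.

(** * Chambers of an abstract reflection group *)

Section Chambers.
Variables (R : realType) (E : vectType R) (n : nat).
Variables (a : 'I_n -> dual R E) (sg : 'I_n -> 'End(E)) (c0 : E).

(** Words stand in for group elements: they allow induction on the last letter and give a countable
    index set for the cover of the face. *)
Definition word (w : seq 'I_n) : 'End(E) := foldr (fun i f => sg i \o f)%VF \1%VF w.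

Definition chamber : set E := [set x | forall i, 0 <= (a i x : R)].
Definition ichamber : set E := [set x | forall i, 0 < (a i x : R)].

Hypothesis sg_fix : forall i x, (a i x : R) = 0 -> sg i x = x.
Hypothesis a_sg : forall i x, (a i (sg i x) : R) = - (a i x : R).
Hypothesis sgK : forall i, involutive (sg i).
Hypothesis c0P : ichamber c0.
Hypothesis wall_point : forall i, exists p,
  (a i p : R) = 0 /\ forall k, k != i -> 0 < (a k p : R).
(** Dual form of the condition that the wall [k] of the chamber spans its hyperplane. *)
Hypothesis wall_span : forall k (f : dual R E),
  (forall x, chamber x -> (a k x : R) = 0 -> (f x : R) = 0) ->
  forall x, (a k x : R) = 0 -> (f x : R) = 0.
Hypothesis W_free : forall w x, ichamber x -> ichamber (word w x) ->
  forall y, word w y = y.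

Lemma word_cat u v x : word (u ++ v) x = word u (word v x).
Proof. by elim: u => [|i u IH] /=; rewrite ?id_lfunE // !comp_lfunE IH. Qed.

Lemma word_cons i w x : word (i :: w) x = sg i (word w x).
Proof. by rewrite /= comp_lfunE. Qed.

Lemma word1 i x : word [:: i] x = sg i x.
Proof. by rewrite word_cons /= id_lfunE. Qed.

Lemma word_revK w : cancel (word w) (word (rev w)).
Proof.
elim: w => [|i w IH] x; first by rewrite /= !id_lfunE.
by rewrite rev_cons -cats1 word_cat word1 word_cons sgK IH.
Qed.

Lemma wordK_rev w : cancel (word (rev w)) (word w).
Proof. by move=> x; rewrite -{1}(revK w) word_revK. Qed.

(* A point of [w C] on the hyperplane of [sg i] would be fixed by [sg i], so
   [w^-1 sg_i w] would move a point of [C] into [C]. *)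
Lemma wall_neq0 i w x : ichamber x -> (a i (word w x) : R) != 0.
Proof.
move=> Cx; apply/eqP => aw0.
have fixW : word (rev w ++ i :: w) x = x.
  by rewrite word_cat word_cons sg_fix // word_revK.
have sg1 y : sg i y = y.
  have := @W_free (rev w ++ i :: w) x Cx; rewrite fixW => /(_ Cx (word (rev w) y)).
  rewrite word_cat word_cons wordK_rev => /(congr1 (word w)).
  by rewrite !wordK_rev.
have := a_sg i c0; rewrite sg1; have := c0P i; lra.
Qed.

(** If [a i] took opposite signs at [word w c0] and [word w x], it would vanish at the image of some
    [t *: c0 + x] with [t > 0], a point of the open chamber, against [wall_neq0]. *)
Lemma wall_sign i w :
  (forall x, chamber x -> 0 <= (a i (word w x) : R)) \/
  (forall x, chamber x -> (a i (word w x) : R) <= 0).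
Proof.
have key x (t : R) : chamber x -> 0 < t ->
    t * (a i (word w c0) : R) + (a i (word w x) : R) != 0.
  move=> Cx t0; have := @wall_neq0 i w (t *: c0 + x).
  rewrite !linearP; apply=> k; rewrite linearP ltr_wpDr ?Cx // mulr_gt0 //.
  exact: c0P.
have [a0|a0|/eqP] := ltgtP (a i (word w c0) : R) 0.
- right=> x Cx; rewrite leNgt; apply/negP => ax.
  have t0 : 0 < - (a i (word w x) : R) / (a i (word w c0) : R).
    by rewrite nmulr_lgt0 ?invr_lt0 // oppr_lt0.
  by have /eqP := key _ _ Cx t0; rewrite divfK ?lt_eqF //; case; lra.
- left=> x Cx; rewrite leNgt; apply/negP => ax.
  have t0 : 0 < - (a i (word w x) : R) / (a i (word w c0) : R).
    by rewrite divr_gt0 // oppr_gt0.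
  by have /eqP := key _ _ Cx t0; rewrite divfK ?gt_eqF //; case; lra.
- by rewrite (negbTE (wall_neq0 i w c0P)).
Qed.

(* [w^-1 sg_i w sg_k] fixes the hyperplane of [k] pointwise and preserves its
   positive side, so it maps a point of [C] near the wall [k] into [C]. *)
Lemma adjacent_chambers w i k :
  (forall x, chamber x -> 0 <= (a i (word w x) : R)) ->
  (forall x, chamber x -> (a i (word w (sg k x)) : R) <= 0) ->
  forall x, sg i (word w x) = word w (sg k x).
Proof.
move=> posw negw.
(* On the wall [k] the map [sg k] is the identity, so the two sign assumptions make [a i] after
   [word w] vanish there. *)
have fker x : (a k x : R) = 0 -> (a i (word w x) : R) = 0.
  pose f : dual R E := (a i \o word w)%VF.
  have fE y : f y = a i (word w y) by rewrite comp_lfunE.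
  rewrite -fE; apply: wall_span => y Cy ky; apply/eqP.
  by rewrite fE eq_le posw // andbT -[y in word w y](sg_fix ky) negw.
pose s := word (rev w ++ i :: w ++ [:: k]).
have sE x : s x = word (rev w) (sg i (word w (sg k x))).
  by rewrite /s word_cat word_cons word_cat word1.
have sfix x : (a k x : R) = 0 -> s x = x.
  by move=> kx; rewrite sE sg_fix ?sg_fix ?word_revK // fker.
(* Since one kernel contains the other, the two forms are proportional; [c0] normalises the
   factor. *)
have fprop x : (a i (word w x) : R) * (a k c0 : R) = (a k x : R) * (a i (word w c0) : R).
  have k0 := c0P k.
  set q := (a k x : R) / (a k c0 : R).
  have qk : q * (a k c0 : R) = a k x by rewrite divfK ?gt_eqF.
  have := fker (x + (- q) *: c0).
  have -> : word w (x + (- q) *: c0) = word w x + (- q) *: word w c0.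
    by rewrite linearD linearZ.
  rewrite !dual_affine -qk mulNr subrr => /(_ erefl) e.
  have {e} -> : (a i (word w x) : R) = q * (a i (word w c0) : R) by lra.
  by rewrite mulrAC.
(* The sign changes caused by [sg i] and [sg k] cancel. *)
have ks : (a k (s c0) : R) = a k c0.
  have := fprop (s c0); have := fprop (sg k c0).
  rewrite sE wordK_rev !a_sg; have := wall_neq0 i w c0P.
  move=> /mulIf nz e1 e2; apply: nz; rewrite -e2; lra.
have s1 x : s x = x.
  have [p [kp pP]] := wall_point k.
  have [j|d d0 dP] := @exists_small R _ (fun j d => 0 < (a j (p + d *: s c0) : R)).
    have [->|jk] := eqVneq j k.
      apply: filterS (nbhs_right_gt 0) => d d0.
      by rewrite dual_affine kp add0r ks mulr_gt0 // c0P.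
    have := near_right_affine_gt0 (a j (s c0) : R) (pP j jk).
    by apply: filterS => d; rewrite dual_affine.
  apply: (@W_free _ (p + d *: c0)) => j.
    rewrite dual_affine ltr_wpDl ?mulr_gt0 //.
    by have [->|/pP/ltW//] := eqVneq j k; rewrite kp.
  by have := dP j; rewrite -[in X in X -> _](sfix p) // -linearZ -linearD.
move=> x; have := s1 (sg k x); rewrite sE sgK => /(congr1 (word w)).
by rewrite wordK_rev.
Qed.

(** The proof builds [u] from reflections in walls of [J], and [v] takes the chamber to the
    nonnegative side of these walls. *)
Lemma parabolic_factor (J : pred 'I_n) nu w : (forall i, J i -> (a i nu : R) = 0) ->
  exists u v, [/\ forall x, word w x = word u (word v x), word u nu = nu &
    forall i, J i -> forall x, chamber x -> 0 <= (a i (word v x) : R)].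
Proof.
move=> nuJ; elim/last_ind: w => [|w k [u [v [wE unu vpos]]]].
  exists [::], [::]; split=> [x||i _ x Cx]; rewrite /= ?id_lfunE //; exact: Cx.
have wkE x : word (rcons w k) x = word u (word v (sg k x)).
  by rewrite -cats1 word_cat word1 wE.
have [pos|] := pselect (forall i, J i -> forall x, chamber x ->
    0 <= (a i (word v (sg k x)) : R)).
  exists u, (rcons v k); split=> // [x|i Ji x Cx].
    by rewrite wkE -[rcons v k]cats1 word_cat word1.
  by rewrite -cats1 word_cat word1; exact: pos.
move=> /existsNP[i /not_implyP[Ji npos]].
(* The next chamber lies on one side of the hyperplane [i], and [npos] leaves the nonpositive one.
   So [sg i] after [v] equals [v] after [sg k], and the letter [i] goes to [u]. *)
have [|neg] := wall_sign i (rcons v k).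
  by move=> pos; case: npos => x /pos; rewrite -cats1 word_cat word1.
have adj : forall x, sg i (word v x) = word v (sg k x).
  apply: adjacent_chambers; first exact: vpos.
  by move=> x /neg; rewrite -cats1 word_cat word1.
exists (rcons u i), v; split=> // [x|].
  by rewrite wkE -adj -[rcons u i]cats1 word_cat word1.
by rewrite -cats1 word_cat word1 sg_fix ?nuJ.
Qed.

(** * Faces of an invariant subcone *)

Section Face.
Variables (Y F : set E) (nu : E).
Hypothesis Y_cone : convex_cone Y.
Hypothesis Y0 : Y 0.
Hypothesis Y_tits : forall y, Y y -> exists w x, chamber x /\ y = word w x.
Hypothesis Y_inv : forall w y, Y y -> Y (word w y).
Hypothesis F_face : face Y F.
Hypothesis F_nu : rel_interior F nu.
Hypothesis C_nu : chamber nu.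

(** Extremality, the contrapositive of the face condition. *)
Lemma face_summand x y : Y x -> Y y -> F (x + y) -> F x.
Proof.
have [_ _ FY] := F_face; move=> Yx Yy Fxy; apply: contrapT => nFx.
have [] // : (Y `\` F) (x + y).
by apply: FY; exists x => //; exists y.
Qed.

(* [nu] is interior to a segment of [F] issuing from [y], and its image under
   [w] is interior to a segment of [Y] issuing from [word w y]. *)
Lemma stabilizer_preserves_face w y : word w nu = nu -> F y -> F (word w y).
Proof.
move=> wnu Fy; have [[FD FZ] FY _] := F_face; have [_ YZ] := Y_cone.
have [d d0 Fd] := rel_interior_extend F_nu Fy.
have Fnu : F nu by case: F_nu.
have d10 : 0 < 1 + d by rewrite addr_gt0.
have -> : word w y = d^-1 *: word w (d *: y).
  by rewrite linearZ scalerA mulVf ?scale1r // gt_eqF.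
apply: (FZ); first by rewrite invr_gt0.
apply: (@face_summand _ (word w (nu + d *: (nu - y)))).
- by apply/Y_inv/YZ => //; exact: FY.
- by apply/Y_inv/FY.
- rewrite -linearD addrC -addrA -scalerDr subrK.
  by rewrite -[X in X + _]scale1r -scalerDl linearZ /= wnu; exact: FZ.
Qed.

Lemma face_cover X' : (forall x, F x -> chamber x -> x \in <<X'>>%VS) ->
  forall y, F y -> exists w, y \in (word w @: <<X'>>)%VS.
Proof.
move=> FX y Fy; have [[FD FZ] FY _] := F_face.
have [w [x [Cx yE]]] := Y_tits (FY _ Fy).
have Fnu : F nu by case: F_nu.
have [//|u [v [wE unu vpos]]] :=
  @parabolic_factor (fun i => (a i nu : R) == 0) nu w; first by move=> i /eqP.
(* At walls through [nu] the sign comes from [vpos]; at the others [nu] is strictly positive, which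
   absorbs a small perturbation. *)
have [i|d d0 dP] := @exists_small R _ (fun i d => 0 <= (a i (nu + d *: word v x) : R)).
  have := C_nu i; rewrite le_eqVlt => /orP[/eqP nui|nui].
    apply: filterS (nbhs_right_gt 0) => d d0.
    rewrite dual_affine -nui add0r mulr_ge0 ?(ltW d0) //.
    by apply: vpos => //; rewrite -nui.
  have := near_right_affine_gt0 (a i (word v x) : R) nui.
  by apply: filterS => d; rewrite dual_affine => /ltW.
(* The inverse of [u] fixes [nu], so it preserves [F] and carries [nu + d *: y] to this point. *)
have Fm : F (nu + d *: word v x).
  have runu : word (rev u) nu = nu by rewrite -{1}unu word_revK.
  have -> : nu + d *: word v x = word (rev u) (nu + d *: y).
    by rewrite linearD linearZ /= runu yE wE word_revK.
  by apply: stabilizer_preserves_face => //; apply: FD => //; exact: FZ.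
exists u.
have -> : y = word u (d^-1 *: ((nu + d *: word v x) - nu)).
  by rewrite addrC addKr scalerA mulVf ?scale1r ?gt_eqF // yE wE.
by rewrite memv_img // memvZ // rpredB // FX.
Qed.

Lemma face_hull : lin_hull F = set_sub F F /\
  set_sub F F = set_sub (F `&` chamber) (F `&` chamber).
Proof.
have [[FD FZ] FY _] := F_face; have [YD YZ] := Y_cone.
have Fnu : F nu by case: F_nu.
have F0 : F 0 by apply: (@face_summand _ nu); rewrite ?add0r //; exact: FY.
have [X [XF FX]] := exists_spanning_seq F.
have [X' [XF' FX']] := exists_spanning_seq (F `&` chamber).
have C0 : chamber 0 by move=> i; rewrite linear0.
have FC_cone : convex_cone (F `&` chamber).
  split=> [x y [Fx Cx] [Fy Cy]|t x t0 [Fx Cx]]; split.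
  - exact: FD.
  - by move=> i; rewrite linearD addr_ge0 ?Cx ?Cy.
  - exact: FZ.
  - by move=> i; rewrite linearZ mulr_ge0 ?Cx ?(ltW t0).
rewrite (lin_hull_span XF FX) !(set_sub_span _ _ XF FX) //.
rewrite (set_sub_span _ _ XF' FX') //; split=> //.
suff -> : <<X>>%VS = <<X'>>%VS by [].
have sub : (<<X'>> <= <<X>>)%VS.
  by apply/span_subvP => x /XF'[Fx _]; exact: FX.
(* A single image of the span of [X'] contains all generators [X] of the span of [F]; a linear image
   cannot have larger dimension. *)
have [w [_ Xw]] := countable_subspace_cover (conj FD FZ)
  (face_cover (fun x Fx Cx => FX' x (conj Fx Cx))) Fnu XF.
apply/eqP; rewrite eq_sym eqEdim sub /=.
rewrite (leq_trans (dimvS (introT span_subvP Xw))) //.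
by rewrite -[leqRHS](limg_ker_dim (word w)) leq_addl.
Qed.

End Face.

End Chambers.

(** * Linear Coxeter systems satisfy the abstract hypotheses *)

Section CoxeterSystem.
Variables (R : realType) (V : vectType R) (n : nat).
Variables (H : 'I_n -> set V) (L : 'I_n -> set (dual R V)) (h : 'I_n -> V).
Hypothesis S : linear_coxeter_system H L.
Hypothesis Hh : forall i, (H i `\ 0) (h i).

(** The image of [h i] in the bidual, in the role of [a i] above; its kernel is the reflecting
    hyperplane. *)
Definition wall_form (i : 'I_n) : dual R (dual R V) :=
  linfun (fun l : dual R V => l (h i) : R^o).

Lemma wall_formE i l : wall_form i l = l (h i).
Proof.
have lin : linear (fun l : dual R V => l (h i) : R^o).
  by move=> t x y; rewrite add_lfunE scale_lfunE.
pose fL := GRing.isLinear.Build R _ _ _ _ lin.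
pose f : {linear dual R V -> R^o} := HB.pack (fun l : dual R V => l (h i) : R^o) fL.
by rewrite /wall_form -[X in linfun X]/(f : _ -> _) lfunE.
Qed.

Lemma ray_mem i : H i (h i). Proof. by case: (Hh i). Qed.

Lemma ray_generator i : h i != 0. Proof. by apply/eqP => h0; case: (Hh i). Qed.

Lemma ray_scale i x : H i x -> exists2 t : R, 0 <= t & x = t *: h i.
Proof.
have [v v0 HE] := lcs_ray S i; have := ray_mem i; have := ray_generator i.
rewrite HE => h0 [t /= t0 tv] [s /= s0 <-].
have tn0 : t != 0 by apply: contra_neq h0 => t00; rewrite -tv t00 scale0r.
by exists (s / t); rewrite ?divr_ge0 // -tv scalerA divfK.
Qed.

Lemma ray_ge0E i l : ray_ge0 (H i) l <-> 0 <= (wall_form i l : R).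
Proof.
rewrite wall_formE; split=> [|l0 x /ray_scale[t t0 ->]]; first by apply; exact: ray_mem.
by rewrite linearZ mulr_ge0.
Qed.

Lemma ray_gt0E i l : ray_gt0 (H i) l <-> 0 < (wall_form i l : R).
Proof.
rewrite wall_formE; split=> [|l0 x /ray_scale[t t0 ->]].
  by apply; [exact: ray_mem | exact: ray_generator].
rewrite scaler_eq0 negb_or => /andP[tn0 _].
by rewrite linearZ mulr_gt0 // lt0r tn0.
Qed.

Lemma ray_eq0E i l : ray_eq0 (H i) l <-> (wall_form i l : R) = 0.
Proof.
rewrite wall_formE; split=> [|l0 x /ray_scale[t t0 ->]]; first by apply; exact: ray_mem.
by rewrite linearZ /= l0 scaler0.
Qed.

Lemma closed_chamberE : closed_chamber H = chamber wall_form.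
Proof.
apply/seteqP; split=> x Cx i; first by apply/ray_ge0E/Cx.
by move=> _; apply/ray_ge0E/Cx.
Qed.

Lemma open_chamberE : open_chamber H = ichamber wall_form.
Proof.
apply/seteqP; split=> x Cx i; first by apply/ray_gt0E/Cx.
by move=> _; apply/ray_gt0E/Cx.
Qed.

Lemma coray_vector i : exists2 l : dual R V, L i l & 0 < (wall_form i l : R).
Proof.
have [l l0 LE] := lcs_coray S i.
have Ll : L i l by rewrite LE; exists 1; rewrite /= ?scale1r.
exists l => //; apply/ray_gt0E/(lcs_pos S); split=> //.
by move/eqP; rewrite (negbTE l0).
Qed.

(** As [refl] is specified only on the hyperplane and on the line, [x] is split into its components
    [x - q *: l] and [q *: l]. *)
Lemma refl_formula i : exists2 l : dual R V, 0 < (wall_form i l : R) &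
  forall x, refl H L i x = x - (2 * (wall_form i x : R) / (wall_form i l : R)) *: l.
Proof.
have [l Ll l0] := coray_vector i; exists l => // x.
have [rfix rneg] := reflP i S.
set q := (wall_form i x : R) / (wall_form i l : R).
have qE : q * (wall_form i l : R) = wall_form i x by rewrite divfK ?gt_eqF.
have xE : x = (x + (- q) *: l) + q *: l by rewrite scaleNr subrK.
have xq : refl H L i (x + (- q) *: l) = x + (- q) *: l.
  by apply/rfix/ray_eq0E; rewrite dual_affine mulNr qE subrr.
have -> : refl H L i x = refl H L i (x + (- q) *: l) + q *: refl H L i l.
  have lin (t : R) u v : refl H L i (u + t *: v) = refl H L i u + t *: refl H L i v.
    by rewrite linearD linearZ.
  by rewrite -lin -xE.
rewrite xq rneg; last by left.
by rewrite scaleNr scalerN -mulrA -/q mulr_natl mulr2n scalerDl opprD addrA.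
Qed.

Lemma refl_fix i x : (wall_form i x : R) = 0 -> refl H L i x = x.
Proof. by move=> x0; apply: (reflP i S).1; apply/ray_eq0E. Qed.

Lemma wall_form_refl i x : (wall_form i (refl H L i x) : R) = - (wall_form i x : R).
Proof.
have [l l0 ->] := refl_formula i.
have ln0 : (wall_form i l : R) != 0 by rewrite gt_eqF.
rewrite -scaleNr dual_affine mulNr divfK //; lra.
Qed.

Lemma refl_fixE i x : refl H L i x = x <-> (wall_form i x : R) = 0.
Proof.
split=> [rx|]; last exact: refl_fix.
by have := wall_form_refl i x; rewrite rx; lra.
Qed.

Lemma reflK i : involutive (refl H L i).
Proof.
move=> x; have rr := wall_form_refl i x; have [l l0 rE] := refl_formula i.
rewrite rE rr rE.
by rewrite mulrN mulNr scaleNr opprK subrK.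
Qed.

(** Words form a subgroup containing the generators, reversal giving inverses. *)
Lemma coxeter_word s : coxeter_group H L s -> exists w, s = word (refl H L) w.
Proof.
move=> /(_ [set g | exists w, g = word (refl H L) w]); apply.
split=> [|_ [i _ <-]]; last by exists [:: i]; rewrite /= comp_lfun1r.
split; first by exists [::].
  move=> _ _ [u ->] [v ->]; exists (u ++ v); apply/lfunP => x.
  by rewrite word_cat comp_lfunE.
move=> _ [w ->]; exists (word (refl H L) (rev w)); first by exists (rev w).
by split; apply/lfunP => x; rewrite comp_lfunE id_lfunE ?word_revK ?wordK_rev //;
  exact: reflK.
Qed.

Lemma word_coxeter w : coxeter_group H L (word (refl H L) w).
Proof.
move=> G [[G1 GM _] Gr]; elim: w => [|i w IH] //=.
by apply: GM => //; apply: Gr; exists i.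
Qed.

Lemma word_free w x : ichamber wall_form x -> ichamber wall_form (word (refl H L) w x) ->
  forall y, word (refl H L) w y = y.
Proof.
rewrite -open_chamberE => Cx Cwx y.
have [->|w1] := eqVneq (word (refl H L) w) \1%VF; first exact: id_lfunE.
have : set0 (word (refl H L) w x).
  by rewrite -(lcs_free S (word_coxeter w) w1); split=> //; exists x.
by [].
Qed.

(** The hull of the wall lies in the kernel of a nonzero form, and both have codimension 1 because
    the chamber spans the whole space. *)
Lemma wall_hull k : lin_hull (closed_chamber H `&` ray_eq0 (H k)) =
  [set x | x \in lker (wall_form k)].
Proof.
have [d [U UE dU] [U1 U1E dU1]] : codim1 (closed_chamber H)
    (closed_chamber H `&` ray_eq0 (H k)).
  have : range (fun i => closed_chamber H `&` ray_eq0 (H i))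
    (closed_chamber H `&` ray_eq0 (H k)) by exists k.
  by rewrite -(lcs_walls S) => -[].
have U1f : U1 = fullv.
  apply/vspaceP => x; rewrite memvf.
  by have := in_setT x; rewrite -(lcs_span S) U1E inE.
rewrite UE; suff -> : U = lker (wall_form k) by [].
apply/eqP; rewrite eqEdim; apply/andP; split.
  apply/subvP => x xU; have : lin_hull (closed_chamber H `&` ray_eq0 (H k)) x.
    by rewrite UE.
  move=> /(_ [set y | y \in lker (wall_form k)]); apply; split.
    by exists (lker (wall_form k)).
  by move=> y [_ /ray_eq0E ky] /=; rewrite memv_ker ky.
have [l _ l0] := coray_vector k.
have : (0 < \dim (limg (wall_form k)))%N.
  rewrite lt0n dimv_eq0; apply: contraTneq l0 => lim0.
  have : wall_form k l \in limg (wall_form k) by rewrite memv_img ?memvf.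
  by rewrite lim0 memv0 => /eqP->; rewrite ltxx.
have := limg_ker_dim (wall_form k) fullv; rewrite capfv -U1f dU1 dU => dE lim0.
by rewrite -ltnS -dE -[ltnLHS]addn0 ltn_add2l.
Qed.

Lemma wall_span k (f : dual R (dual R V)) :
  (forall x, chamber wall_form x -> (wall_form k x : R) = 0 -> (f x : R) = 0) ->
  forall x, (wall_form k x : R) = 0 -> (f x : R) = 0.
Proof.
move=> f0 x kx.
have : lin_hull (closed_chamber H `&` ray_eq0 (H k)) x.
  by rewrite wall_hull /= memv_ker kx.
move=> /(_ [set x | x \in lker f]) /=; rewrite memv_ker => fx; apply/eqP/fx.
split; first by exists (lker f).
move=> y [Cy /ray_eq0E ky] /=; rewrite memv_ker; apply/eqP/f0 => //.
by rewrite -closed_chamberE.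
Qed.

(* Otherwise the wall [i] lies on the hyperplane of [k]; as it spans its own
   hyperplane, the two walls coincide. *)
Lemma wall_point_off i k : k != i ->
  exists p, [/\ chamber wall_form p, (wall_form i p : R) = 0 & 0 < (wall_form k p : R)].
Proof.
move=> ki; apply: contrapT => nop.
have ik : forall x, (wall_form i x : R) = 0 -> (wall_form k x : R) = 0.
  apply: wall_span => x Cx ix; apply/eqP; rewrite eq_le Cx andbT leNgt.
  by apply/negP => kx; apply: nop; exists x.
have [l _ il] := coray_vector i; have [m _ km] := coray_vector k.
have prop x : (wall_form k x : R) * (wall_form i l : R) =
    (wall_form i x : R) * (wall_form k l : R).
  set q := (wall_form i x : R) / (wall_form i l : R).
  have qE : q * (wall_form i l : R) = wall_form i x by rewrite divfK ?gt_eqF.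
  have := ik (x + (- q) *: l); rewrite !dual_affine -qE mulNr subrr => /(_ erefl) e.
  have -> : (wall_form k x : R) = q * (wall_form k l : R) by lra.
  by rewrite mulrAC.
have kl0 : (wall_form k l : R) != 0.
  apply/eqP => kl; have /eqP := prop m.
  by rewrite kl mulr0 mulf_eq0 !gt_eqF.
have ki0 x : (wall_form k x : R) = 0 -> (wall_form i x : R) = 0.
  by move=> kx; apply: (mulIf kl0); rewrite -prop kx !mul0r.
move/eqP: ki; apply; apply: (lcs_walls_inj S); apply/seteqP.
by split=> x [Cx /ray_eq0E x0]; split=> //; apply/ray_eq0E; [exact: ki0 | exact: ik].
Qed.

(** Sum, over [k != i], points of the wall [i] that lie off the hyperplane [k]. *)
Lemma wall_point i : exists p,
  (wall_form i p : R) = 0 /\ forall k, k != i -> 0 < (wall_form k p : R).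
Proof.
have /choice[p pP] k : exists p : dual R V, chamber wall_form p /\
    (k != i -> (wall_form i p : R) = 0 /\ 0 < (wall_form k p : R)).
  have [->|/wall_point_off[p [Cp ip kp]]] := eqVneq k i; last by exists p.
  (* The value for [k = i] is a default that does not enter the sum. *)
  by exists 0; split=> // j; rewrite linear0.
exists (\sum_(k | k != i) p k); split.
  by rewrite linear_sum big1 // => k /(pP k).2[].
move=> k ki; rewrite linear_sum (bigD1 k) //= ltr_pwDl //.
  by have [] := (pP k).2 ki.
by apply: sumr_ge0 => j _; apply: (pP j).1.
Qed.

(** A spanning chamber lies in no hyperplane, so each form is positive at some point of it; these
    points are summed. *)
Lemma exists_ichamber : exists c, ichamber wall_form c.
Proof.
have /choice[c cP] i : exists c : dual R V,
    chamber wall_form c /\ 0 < (wall_form i c : R).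
  apply: contrapT => noc; have [l _] := coray_vector i.
  have : lin_hull (closed_chamber H) l by rewrite (lcs_span S).
  move=> /(_ [set x | x \in lker (wall_form i)]) /=; rewrite memv_ker => kl.
  rewrite (eqP (kl _)) ?ltxx //; split; first by exists (lker (wall_form i)).
  rewrite closed_chamberE => x Cx /=; rewrite memv_ker eq_le Cx andbT leNgt.
  by apply/negP => ix; apply: noc; exists x.
exists (\sum_k c k) => i; rewrite linear_sum (bigD1 i) //= ltr_pwDl //.
  by have [] := cP i.
by apply: sumr_ge0 => j _; apply: (cP j).1.
Qed.

End CoxeterSystem.

Theorem corollary4p4 (R : realType) (V : vectType R) (n : nat)
    (H : 'I_n -> set V) (L : 'I_n -> set (dual R V)) (h : 'I_n -> V)
    (Y F : set (dual R V)) :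
  (0 < n)%N ->
  linear_coxeter_system H L ->
  (forall i, (H i `\ 0) (h i)) ->
  convex_cone Y ->
  Y 0 ->
  Y `<=` tits_cone H L ->
  (forall s, coxeter_group H L s -> [set s x | x in Y] `<=` Y) ->
  Upsilon H Y F ->
  let C := closed_chamber H in
  let FJ := closed_facet h (upsilon_star H L F) in
  [/\ lin_hull F = set_sub F F,
      set_sub F F = set_sub (F `&` C) (F `&` C) &
      set_sub (F `&` C) (F `&` C) = set_sub (F `&` FJ) (F `&` FJ)].
Proof.
move=> _ S Hh Y_cone Y0 Y_tits Y_inv [[F_face _] [nu [F_nu C_nu]]] C FJ.
have [c0 c0P] := exists_ichamber S Hh.
have CE : C = chamber (wall_form h) := closed_chamberE S Hh.
have [hullE subE] : lin_hull F = set_sub F F /\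
    set_sub F F = set_sub (F `&` chamber (wall_form h)) (F `&` chamber (wall_form h)).
  apply: (@face_hull _ _ _ (wall_form h) (refl H L) c0 _ _ _ c0P _ _ _ Y F nu) => //.
  - exact: (refl_fix S Hh).
  - exact: (wall_form_refl S Hh).
  - exact: (reflK S Hh).
  - exact: (wall_point S Hh).
  - exact: (wall_span S Hh).
  - exact: (word_free S Hh).
  - move=> y /Y_tits[s Ws [x Cx <-]]; have [w ->] := coxeter_word S Hh Ws.
    by exists w, x; rewrite -CE.
  - move=> w y Yy; apply: (Y_inv (word (refl H L) w)); last by exists y.
    exact: word_coxeter.
  - by rewrite -CE.
(* The last equality holds already between the two cones: a reflection fixing [F] pointwise forces
   its form to vanish on [F]. *)
suff FCE : F `&` C = F `&` FJ by rewrite CE in FCE *; split; rewrite // FCE.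
rewrite CE; apply/seteqP; split=> x [Fx Cx]; split=> //.
  split=> i; last by move=> _; rewrite -wall_formE; exact: Cx.
  by move=> /(_ x Fx) /(refl_fixE S Hh); rewrite wall_formE.
move=> i; rewrite wall_formE; have [Fi|nFi] := pselect (upsilon_star H L F i).
  by rewrite Cx.1.
exact: Cx.2.
Qed.
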